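(* Let $k$ be a positive integer. In any graph $G$, every vertex belonging to an adjacency resolving set of $G$ of size $k$ has degree at most $2^{k-1}+k-1$. Moreover, this bound is sharp: for every positive integer $k$ there exist a graph $G$ and an adjacency resolving set of $G$ of size $k$ containing a vertex of degree $2^{k-1}+k-1$.
   Context: Graphs are finite, simple, undirected, possibly disconnected; $\textnormal{dist}(u,v)=\infty$ between different components. A set $S=\{v_1,\dots,v_k\}$ of vertices is an adjacency resolving set of $G$ if the vectors $(\min(2,\textnormal{dist}(u,v_1)),\dots,\min(2,\textnormal{dist}(u,v_k)))$ are pairwise distinct over $u\in V(G)$. *)

(* Defs.v *)
From mathcomp Require Import all_boot.

Set Implicit Arguments.
Unset Strict Implicit.
Unset Printing Implicit Defensive.

Record sgraph := SGraph {
  vertex :> finType;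
  adj : rel vertex;
  adj_sym : symmetric adj;
  adj_irrefl : irreflexive adj
}.

Definition deg (G : sgraph) (v : G) : nat := #|[set u | adj v u]|.

Definition has_walk (G : sgraph) (u v : G) (n : nat) : bool :=
  [exists p : n.-tuple G, path (@adj G) u p && (last u p == v)].

Lemma connect_has_walk (G : sgraph) (u v : G) :
  connect (@adj G) u v -> exists n, has_walk u v n.
Proof.
case/connectP=> p up ->; exists (size p); apply/existsP.
by exists (in_tuple p); rewrite up eqxx.
Qed.

(* The length of a shortest walk; None stands for infinity. *)
Definition dist (G : sgraph) (u v : G) : option nat :=
  match @idP (connect (@adj G) u v) with
  | ReflectT uv => Some (ex_minn (connect_has_walk uv))
  | ReflectF _ => None
  end.

(* min(2, d), where min(2, infinity) = 2. *)
Definition min2 (d : option nat) : nat :=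
  if d is Some n then minn 2 n else 2.

(* The order of the coordinates is that of enum S; it is the same for all u. *)
Definition adj_vector (G : sgraph) (S : {set G}) (u : G) : seq nat :=
  [seq min2 (dist u v) | v <- enum S].

Definition adjacency_resolving (G : sgraph) (S : {set G}) : Prop :=
  forall u w : G, u != w -> adj_vector S u <> adj_vector S w.

(* Main.v *)
Require Import Defs.
From HB Require Import structures.
From mathcomp Require Import all_boot.

(** Two vertices outside a resolving set [S] have different neighbourhoods in
[S], since all their coordinates are 1 or 2.  The neighbours of [v \in S]
outside [S] all see [v], hence are determined by their neighbourhoods in
[S :\ v]: there are at most [2 ^ (k - 1)] of them, besides the at most [k - 1]
neighbours inside [S].  Equality occurs when [v] is joined to all other
vertices, namely [k - 1] independent ones together with one vertex for each
subset of these, joined exactly to the members of that subset. *)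

(** Walks of length 0 and 1 are equality and adjacency; a longer shortest walk is truncated to 2,
    which is also the value across components. *)
Lemma min2_dist (G : sgraph) (u v : G) :
  min2 (dist u v) = if u == v then 0 else if adj u v then 1 else 2.
Proof.
have walk0 : has_walk u v 0 = (u == v).
  apply/existsP/eqP => [[p]|->]; first by rewrite tuple0 /= => /eqP.
  by exists [tuple]; rewrite /= eqxx.
have walk1 : has_walk u v 1 = adj u v.
  apply/existsP/idP => [[p]|uv]; last by exists [tuple v]; rewrite /= uv eqxx.
  by case/tupleP: p => x p; rewrite tuple0 /= andbT => /andP[ux /eqP <-].
rewrite /dist; case: {-}_ / idP => [uv|nuv] /=.
  case: ex_minnP => -[|[|n]] wn min_n.
  - by rewrite -walk0 wn.
  - have /negbTE-> : u != v by rewrite -walk0; apply/negP => /min_n.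
    by rewrite -walk1 wn.
  - have /negbTE-> : u != v by rewrite -walk0; apply/negP => /min_n.
    have /negbTE-> : ~~ adj u v by rewrite -walk1; apply/negP => /min_n.
    exact/minn_idPl.
case: eqP nuv => [->|_ nuv]; first by rewrite connect0.
by case: ifP => // /connect1.
Qed.

(** Trades vectors indexed by [enum S] for coordinatewise agreement on [S]. *)
Lemma adjacency_resolvingP (G : sgraph) (S : {set G}) :
  adjacency_resolving S <->
  forall u w : G,
    {in S, forall s, min2 (dist u s) = min2 (dist w s)} -> u = w.
Proof.
split=> [resS u w eq_uw|resS u w /eqP neq_uw eq_uw].
  apply/eqP; apply: contraT => /resS; case.
  by apply/eq_in_map => s; rewrite mem_enum => /eq_uw.
by apply/neq_uw/resS => s sS; move/eq_in_map: eq_uw; apply; rewrite mem_enum.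
Qed.

Lemma deg_resolving_le (G : sgraph) (S : {set G}) (v : G) :
  adjacency_resolving S -> v \in S -> deg v <= 2 ^ #|S :\ v| + #|S :\ v|.
Proof.
move=> /adjacency_resolvingP resS vS.
rewrite /deg -(cardsID S) addnC leq_add //; last first.
  apply/subset_leq_card/subsetP => u; rewrite !inE => /andP[vu ->].
  by rewrite andbT; apply: contraTneq vu => ->; rewrite adj_irrefl.
pose trace u := [set s in S :\ v | adj u s].
rewrite -card_powerset -(@card_in_imset _ _ trace).
  apply/subset_leq_card/subsetP => _ /imsetP[u _ ->].
  by rewrite inE; apply/subsetP => s; rewrite inE => /andP[].
(* Injectivity of [trace]: no coordinate is 0 outside [S], the one at [v] is 1 for both vertices,
   and the traces determine the others. *)
move=> u w; rewrite !inE => /andP[uS vu] /andP[wS vw] /setP eq_uw.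
apply: resS => s sS; rewrite !min2_dist.
have /negbTE-> : u != s by apply: contraNneq uS => ->.
have /negbTE-> : w != s by apply: contraNneq wS => ->.
have [->|neq_sv] := eqVneq s v; first by rewrite ![adj _ v]adj_sym vu vw.
by move: (eq_uw s); rewrite !inE neq_sv sS /= => ->.
Qed.

Section Extremal.
Variable m : nat.

(** [None] is the vertex of large degree, [inl i] the other members of the resolving set, and
    [inr A] the vertex attached to the subset [A]. *)
Definition extremal_vertex : Type := option ('I_m + {set 'I_m}).
HB.instance Definition _ := Finite.on extremal_vertex.

Definition extremal_adj (x y : extremal_vertex) : bool :=
  match x, y with
  | None, Some _ | Some _, None => true
  | Some (inl i), Some (inr A) | Some (inr A), Some (inl i) => i \in A
  | _, _ => false
  end.

Lemma extremal_adj_sym : symmetric extremal_adj.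
Proof. by move=> [[i|A]|] [[j|B]|]. Qed.

Lemma extremal_adj_irrefl : irreflexive extremal_adj.
Proof. by move=> [[i|A]|]. Qed.

Definition extremal_graph : sgraph :=
  SGraph extremal_adj_sym extremal_adj_irrefl.

Definition extremal_set : {set extremal_graph} :=
  [set x : extremal_graph | if x is Some (inr _) then false else true].

Lemma extremal_resolving : adjacency_resolving extremal_set.
Proof.
have in_eq (u w : extremal_graph) : u \in extremal_set ->
    {in extremal_set, forall s, min2 (dist u s) = min2 (dist w s)} -> u = w.
  (* The coordinate at [u] is 0 for [u] alone. *)
  by move=> uS /(_ _ uS); rewrite !min2_dist eqxx; case: eqP => //; case: ifP.
apply/adjacency_resolvingP => u w eq_uw.
have [uS|uS] := boolP (u \in extremal_set); first exact: in_eq.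
have [wS|wS] := boolP (w \in extremal_set).
  by apply/esym/in_eq => // s /eq_uw.
move: u w uS wS eq_uw => [[i|A]|] [[j|B]|]; rewrite !inE // => _ _ eq_uw.
congr (Some (inr _)); apply/setP => i.
(* The coordinate at [inl i] is 1 or 2 according to membership of [i]. *)
have := eq_uw (Some (inl i)); rewrite !min2_dist inE /= => /(_ isT).
by case: (i \in A); case: (i \in B).
Qed.

Lemma card_extremal_set : #|extremal_set| = m.+1.
Proof.
rewrite -[m in RHS]card_ord -card_option -cardsT.
(* The set is the injective image of [option 'I_m]. *)
rewrite -(card_imset _ (_ : injective (omap (@inl 'I_m {set 'I_m})))).
  apply: eq_card => x; rewrite inE; apply/idP/imsetP => [|[[i|] _ ->] //].
  by case: x => [[i|A]|] // _; [exists (Some i) | exists None].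
by move=> [i|] [j|] // [->].
Qed.

Lemma deg_extremal : deg (None : extremal_graph) = 2 ^ m + m.
Proof.
have -> : deg (None : extremal_graph) = #|[set~ None : extremal_vertex]|.
  by apply: eq_card => -[x|]; rewrite !inE.
rewrite cardsC1 card_option card_sum card_ord /= addnC.
by rewrite -cardsT -powersetT card_powerset cardsT card_ord.
Qed.

End Extremal.

Theorem theorem16 :
  (forall k : nat, 0 < k ->
     forall (G : sgraph) (S : {set G}), adjacency_resolving S -> #|S| = k ->
     forall v : G, v \in S -> deg v <= 2 ^ (k - 1) + k - 1)
  /\
  (forall k : nat, 0 < k ->
     exists (G : sgraph) (S : {set G}),
       [/\ adjacency_resolving S, #|S| = k
         & exists2 v : G, v \in S & deg v = 2 ^ (k - 1) + k - 1]).
Proof.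
split=> [k k_gt0 G S resS cardS v vS|[//|m] _].
  have := deg_resolving_le _ _ _ resS vS.
  by rewrite -addnBA // -cardS (cardsD1 v S) vS addKn.
(* Here [k] is [m.+1], so [m] is [k - 1]. *)
exists (extremal_graph m), (extremal_set m); split.
- exact: extremal_resolving.
- exact: card_extremal_set.
- by exists None; rewrite ?inE // deg_extremal subn1 addnS subn1.
Qed.
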